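(* Let $L,M$ be locales and let $f\colon L\to M$ be an order-preserving map. Define $f_{\mathfrak o}^{\Rightarrow},f_{\mathfrak o}^{\to}\colon \mathfrak o L\to\mathfrak o M$ by $f_{\mathfrak o}^{\Rightarrow}(\mathfrak o(a))=\mathrm{int}(f[\mathfrak o(a)])$ and $f_{\mathfrak o}^{\to}(\mathfrak o(a))=\big(\mathrm{cl}(f[\mathfrak c(a)])\big)^{\mathsf c}$, and $f_{\mathfrak o}^{\leftarrow}\colon \mathfrak o M\to\mathfrak o L$ by $f_{\mathfrak o}^{\leftarrow}(\mathfrak o(b))=\mathrm{int}(f^{-1}[\mathfrak o(b)])$. Then $f$ is an open localic map if and only if $f_{\mathfrak o}^{\Rightarrow}\dashv f_{\mathfrak o}^{\leftarrow}\dashv f_{\mathfrak o}^{\to}$.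
   Context: A locale (= frame) is a complete lattice $L$ with $(\bigvee A)\wedge b=\bigvee\{a\wedge b\mid a\in A\}$ for all $A\subseteq L$, $b\in L$; it has a Heyting operation $\to$ with $a\wedge b\le c\iff a\le b\to c$. A frame homomorphism preserves all joins and all finite meets (including $0$ and $1$). A localic map $f\colon L\to M$ is a right adjoint of a frame homomorphism $M\to L$. For $a\in L$: $\mathfrak c(a)=\{x\in L\mid x\ge a\}$ (closed sublocale), $\mathfrak o(a)=\{x\in L\mid a\to x=x\}$ (open sublocale). Complements $(-)^{\mathsf c}$ are taken in the lattice of sublocales, so $\mathfrak c(a)^{\mathsf c}=\mathfrak o(a)$ and $\mathfrak o(a)^{\mathsf c}=\mathfrak c(a)$. $\mathfrak o L=\{\mathfrak o(a)\mid a\in L\}$, ordered by inclusion. For any subset $S\subseteq L$, $\mathrm{cl}\,S=\mathfrak c(\bigwedge S)$ and $\mathrm{int}\,S=\mathfrak o(\bigvee\{a\in L\mid \mathfrak o(a)\subseteq S\})$. A map $f\colon L\to M$ is open if for every $a\in L$ the image $f[\mathfrak o(a)]$ is an open sublocale of $M$; an open localic map is a localic map that is open. For posets $X,Y$ and order-preserving maps $g\colon X\to Y$, $h\colon Y\to X$, $g\dashv h$ means $g(x)\le y\iff x\le h(y)$ for all $x\in X$, $y\in Y$. *)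

(* Defs.v *)
From HB Require Import structures.
From mathcomp Require Import all_boot all_order.
From mathcomp Require Import boolp classical_sets.

Set Implicit Arguments.
Unset Strict Implicit.
Unset Printing Implicit Defensive.

Import Order.TTheory.
Local Open Scope classical_set_scope.
Local Open Scope order_scope.

HB.mixin Record TBLattice_isComplete (d : Order.disp_t) L
    of Order.TBLattice d L := {
  bigjoin : set L -> L;
  bigjoinP : forall A : set L, supremums A (bigjoin A)
}.

#[short(type="completeLatticeType")]
HB.structure Definition CompleteLattice (d : Order.disp_t) :=
  { L of TBLattice_isComplete d L & Order.TBLattice d L }.

HB.mixin Record CompleteLattice_isFrame (d : Order.disp_t) L
    of CompleteLattice d L := {
  bigjoinIl : forall (A : set L) (b : L),
    bigjoin A `&` b = bigjoin [set (a `&` b)%O | a in A]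
}.

#[short(type="frameType")]
HB.structure Definition Frame (d : Order.disp_t) :=
  { L of CompleteLattice_isFrame d L & CompleteLattice d L }.

Definition bigmeet (d : Order.disp_t) (L : completeLatticeType d)
  (A : set L) : L := bigjoin (lbound A).

Definition himp (d : Order.disp_t) (L : frameType d) (a b : L) : L :=
  bigjoin [set x : L | (x `&` a)%O <= b].

Section CompleteLatticeTheory.
Context (d : Order.disp_t) (L : completeLatticeType d).
Implicit Types (a b x y : L) (A B : set L).

Lemma bigjoin_ub A x : A x -> x <= bigjoin A.
Proof. by case: (bigjoinP A) => + _; apply. Qed.

Lemma bigjoin_le A x : (forall y, A y -> y <= x) -> bigjoin A <= x.
Proof. by case: (bigjoinP A) => _; apply. Qed.

Lemma bigmeetP A : infimums A (bigmeet A).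
Proof.
split=> [x Ax|x lx]; last exact: bigjoin_ub.
by apply: bigjoin_le => y; apply.
Qed.

Lemma bigmeet_lb A x : A x -> bigmeet A <= x.
Proof. by case: (bigmeetP A) => + _; apply. Qed.

Lemma le_bigmeet A x : (forall y, A y -> x <= y) -> x <= bigmeet A.
Proof. by case: (bigmeetP A) => _; apply. Qed.

Lemma bigmeetS A B : A `<=` B -> bigmeet B <= bigmeet A.
Proof. by move=> AB; apply: le_bigmeet => y /AB; exact: bigmeet_lb. Qed.

Lemma bigjoinS A B : A `<=` B -> bigjoin A <= bigjoin B.
Proof. by move=> AB; apply: bigjoin_le => y /AB; exact: bigjoin_ub. Qed.

End CompleteLatticeTheory.

Section HeytingTheory.
Context (d : Order.disp_t) (L : frameType d).
Implicit Types (a b c x y : L) (A : set L).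

Lemma himpP a b c : ((a `&` b)%O <= c) = (a <= himp b c).
Proof.
apply/idP/idP => [abc|le_a]; first exact: bigjoin_ub.
apply: (le_trans (leI2 le_a (lexx b))).
by rewrite bigjoinIl; apply: bigjoin_le => _ [x xbc <-].
Qed.

Lemma himp_mp a b : (himp a b `&` a)%O <= b.
Proof. by rewrite himpP. Qed.

Lemma le_himp a b : b <= himp a b.
Proof. by rewrite -himpP leIl. Qed.

Lemma himp_top a b : a <= b -> himp a b = \top.
Proof. by move=> ab; apply: le_anti; rewrite lex1 -himpP meet1x ab. Qed.

Lemma himpI a b c : himp a (b `&` c)%O = (himp a b `&` himp a c)%O.
Proof.
apply: le_anti; apply/andP; split.
  rewrite lexI -!himpP.
  by apply/andP; split; apply: (le_trans (himp_mp _ _)); rewrite ?leIl ?leIr.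
rewrite -himpP lexI; apply/andP; split.
  by rewrite himpP leIl.
by rewrite himpP leIr.
Qed.

Lemma himpCA a b c : himp a (himp b c) = himp b (himp a c).
Proof.
suff le a' b' : himp a' (himp b' c) <= himp b' (himp a' c).
  by apply: le_anti; rewrite !le.
by rewrite -!himpP -meetA [(b' `&` a')%O]meetC meetA !himpP.
Qed.

Lemma himp_idem a b : himp a (himp a b) = himp a b.
Proof.
apply: le_anti; rewrite le_himp andbT -himpP.
suff -> : forall y, (y `&` a)%O = ((y `&` a) `&` a)%O by rewrite !himpP.
by move=> y; rewrite -meetA meetxx.
Qed.

Lemma himp_anti a b c : a <= b -> himp b c <= himp a c.
Proof. by move=> ab; rewrite -himpP; apply: le_trans (himp_mp b c); exact: leI2. Qed.

Lemma le_himpr a b c : b <= c -> himp a b <= himp a c.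
Proof. by move=> bc; rewrite -himpP; exact: le_trans (himp_mp a b) bc. Qed.

End HeytingTheory.

Definition is_sublocale (d : Order.disp_t) (L : frameType d) (S : set L) : Prop :=
  (forall A : set L, A `<=` S -> S (bigmeet A)) /\
  (forall x s : L, S s -> S (himp x s)).

(* Binary join in the lattice of sublocales ordered by inclusion; the binary
   meet there is the intersection, the top is L and the bottom is {1}. *)
Definition sublocale_join (d : Order.disp_t) (L : frameType d)
    (S T : set L) : set L :=
  [set x | forall U : set L, is_sublocale U -> S `<=` U -> T `<=` U -> U x].

Definition is_sublocale_compl (d : Order.disp_t) (L : frameType d)
    (S T : set L) : Prop :=
  [/\ is_sublocale T, (S `&` T)%classic = [set \top]%classic & sublocale_join S T = setT].

(* The complement of a complemented sublocale (a junk value otherwise). *)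
Definition sublocale_compl (d : Order.disp_t) (L : frameType d)
    (S : set L) : set L :=
  xget set0 [set T | is_sublocale_compl S T].

Definition closed_subl (d : Order.disp_t) (L : frameType d) (a : L) : set L :=
  [set x | a <= x].

Definition open_subl (d : Order.disp_t) (L : frameType d) (a : L) : set L :=
  [set x | himp a x = x].

Section SublocaleTheory.
Context (d : Order.disp_t) (L : frameType d).
Implicit Types (a b c x y : L) (S T : set L).

Lemma closed_is_sublocale a : is_sublocale (closed_subl a).
Proof.
split=> [A Aa|x s /=]; first by apply: le_bigmeet => y /Aa.
by move=> as_; exact: le_trans as_ (le_himp _ _).
Qed.

Lemma open_is_sublocale a : is_sublocale (open_subl a).
Proof.
split=> [A Aa|x s /= as_]; last by rewrite /open_subl /= himpCA as_.
apply: le_anti; rewrite le_himp andbT; apply: le_bigmeet => y Ay.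
by rewrite -(Aa _ Ay); apply: le_himpr; exact: bigmeet_lb.
Qed.

Lemma sublocaleI S x y : is_sublocale S -> S x -> S y -> S (x `&` y)%O.
Proof.
move=> [SI _] Sx Sy; have -> : (x `&` y)%O = bigmeet ([set x; y]%classic).
  apply: le_anti; apply/andP; split.
    by apply: le_bigmeet => z [->|->]; rewrite ?leIl ?leIr.
  by rewrite lexI; apply/andP; split; apply: bigmeet_lb; [left|right].
by apply: SI => z [->|->].
Qed.

Lemma sublocale1 S : is_sublocale S -> S \top.
Proof.
move=> [SI _]; suff -> : \top = bigmeet (set0 : set L) by apply: SI.
by apply/eqP; rewrite eq_sym -le1x; apply: le_bigmeet.
Qed.

Lemma sublocale_joinE S T : is_sublocale S -> is_sublocale T ->
  sublocale_join S T = [set (s `&` t)%O | s in S & t in T].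
Proof.
move=> sS sT; apply/seteqP; split=> [x|x [s Ss [t Tt <-]] U sU SU TU]; last first.
  by apply: sublocaleI => //; [exact: SU|exact: TU].
apply; last 2 first.
- by move=> s Ss; exists s => //; exists \top; [exact: sublocale1|rewrite meetx1].
- by move=> t Tt; exists \top; [exact: sublocale1|exists t => //; rewrite meet1x].
split=> [A AU|y _ [s Ss [t Tt <-]]]; last first.
  exists (himp y s); first exact: sS.2.
  by exists (himp y t); [exact: sT.2|rewrite himpI].
exists (bigmeet (S `&` [set s | bigmeet A <= s])%classic).
  by apply: sS.1 => s [].
exists (bigmeet (T `&` [set t | bigmeet A <= t])%classic).
  by apply: sT.1 => t [].
apply: le_anti; apply/andP; split; last first.
  by rewrite lexI; apply/andP; split; apply: le_bigmeet => z [].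
apply: le_bigmeet => z Az; have [s Ss [t Tt stz]] := AU _ Az.
have Az' := bigmeet_lb Az.
rewrite -stz; apply: leI2; apply: bigmeet_lb; split=> //=;
  by apply: (le_trans Az'); rewrite -stz ?leIl ?leIr.
Qed.

Lemma closed_openI a : (closed_subl a `&` open_subl a)%classic = [set \top]%classic.
Proof.
apply/seteqP; split=> [x [/= ax <-]|x /= ->]; first exact: himp_top.
by split; rewrite /closed_subl /open_subl /= ?lex1 // himp_top ?lex1.
Qed.

Lemma closed_openU a x : x = ((a `|` x) `&` himp a x)%O.
Proof.
apply: le_anti; rewrite lexI leUr le_himp /=.
rewrite himpP leUx -!himpP leIl andbT meetC.
exact: himp_mp.
Qed.

Lemma closed_open_compl a : is_sublocale_compl (closed_subl a) (open_subl a).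
Proof.
split; [exact: open_is_sublocale|exact: closed_openI|].
rewrite sublocale_joinE; [|exact: closed_is_sublocale|exact: open_is_sublocale].
apply/seteqP; split=> // x _; exists (a `|` x)%O; first exact: leUl.
exists (himp a x); first exact: himp_idem.
by rewrite -closed_openU.
Qed.

Lemma is_sublocale_complC S T :
  is_sublocale S -> is_sublocale_compl S T -> is_sublocale_compl T S.
Proof.
move=> sS [sT STI STU]; split=> //; first by rewrite setIC.
by rewrite -STU; apply/seteqP; split=> x h U sU ? ?; exact: h.
Qed.

Lemma open_closed_compl a : is_sublocale_compl (open_subl a) (closed_subl a).
Proof.
apply: is_sublocale_complC; first exact: closed_is_sublocale.
exact: closed_open_compl.
Qed.

Lemma sublocale_compl_closed a : sublocale_compl (closed_subl a) = open_subl a.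
Proof.
apply: xget_unique; first exact: closed_open_compl.
move=> T [sT TI TU]; apply/seteqP; split=> t /= tT.
- have : (closed_subl a `&` T)%classic (himp (himp a t) t).
    split; last exact: sT.2.
    by rewrite /closed_subl /= -himpP meetC himp_mp.
  rewrite TI /= => h; apply: le_anti.
  by rewrite le_himp andbT -[X in X <= _]meet1x himpP h.
- have : sublocale_join (closed_subl a) T t by rewrite TU.
  rewrite (sublocale_joinE (closed_is_sublocale a) sT) => -[u au [v Tv uv]].
  have -> : t = himp a v; last exact: sT.2.
  by rewrite -tT -uv himpI (himp_top au) meet1x.
Qed.

Lemma sublocale_compl_open a : sublocale_compl (open_subl a) = closed_subl a.
Proof.
apply: xget_unique; first exact: open_closed_compl.
move=> T [sT TI TU]; apply/seteqP; split=> t /= tT.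
- have : (open_subl a `&` T)%classic (himp a t).
    by split; [exact: himp_idem|exact: sT.2].
  by rewrite TI /= /closed_subl /= => h; rewrite -[X in X <= _]meet1x himpP h.
- have : sublocale_join (open_subl a) T t by rewrite TU.
  rewrite (sublocale_joinE (open_is_sublocale a) sT) => -[u au [v Tv uv]].
  have u1 : u = \top.
    by rewrite -au himp_top //; apply: le_trans tT _; rewrite -uv leIl.
  by rewrite -uv u1 meet1x.
Qed.

Lemma open_subl_le a b : (open_subl a `<=` open_subl b) <-> (a <= b).
Proof.
split=> [ab|ab x /= ax]; last first.
  apply: le_anti; rewrite le_himp andbT -[X in _ <= X]ax.
  exact: himp_anti.
have hb : himp b (himp a b) = himp a b by apply: ab; exact: himp_idem.
rewrite himp_top ?le_himp // in hb.
by rewrite -[X in X <= _]meet1x himpP -hb.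
Qed.

Lemma open_subl_inj : injective (@open_subl d L).
Proof.
move=> a b ab; apply: le_anti; apply/andP.
by split; apply/open_subl_le; rewrite ab.
Qed.

End SublocaleTheory.

(* The poset of open sublocales, ordered by inclusion. *)
Record opens (d : Order.disp_t) (L : frameType d) := MkOpens {
  opens_set :> set L;
  opensP : `[< exists a : L, opens_set = open_subl a >]
}.

HB.instance Definition _ (d : Order.disp_t) (L : frameType d) :=
  [isSub for @opens_set d L].
HB.instance Definition _ (d : Order.disp_t) (L : frameType d) :=
  [Choice of opens L by <:].
HB.instance Definition _ (d : Order.disp_t) (L : frameType d) :=
  [SubChoice_isSubPOrder of opens L by <: with set_display].

Lemma opens_leE (d : Order.disp_t) (L : frameType d) (U V : opens L) :
  (U <= V) = ((U : set L) `<=` V) :> Prop.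
Proof. exact: subsetEset. Qed.

Definition mkopen (d : Order.disp_t) (L : frameType d) (a : L) : opens L :=
  @MkOpens d L (open_subl a) (asboolT (ex_intro _ a erefl)).

(* The a, unique by open_subl_inj, such that U = o(a). *)
Definition opens_idx (d : Order.disp_t) (L : frameType d) (U : opens L) : L :=
  xget \bot [set a : L | (U : set L) = open_subl a].

Lemma mkopenK (d : Order.disp_t) (L : frameType d) :
  cancel (@mkopen d L) (@opens_idx d L).
Proof. by move=> a; apply: xget_unique => //= b /open_subl_inj. Qed.

Lemma opens_idxK (d : Order.disp_t) (L : frameType d) :
  cancel (@opens_idx d L) (@mkopen d L).
Proof.
move=> U; apply: val_inj => /=; have /asboolP [a Ua] := opensP U.
by rewrite /opens_idx; case: xgetP => [b _ /= <-//|/(_ a)].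
Qed.

(* S ranges over arbitrary subsets of L, not only sublocales. *)
Definition closure_subl (d : Order.disp_t) (L : frameType d) (S : set L) : set L :=
  closed_subl (bigmeet S).

Definition interior_subl (d : Order.disp_t) (L : frameType d) (S : set L) : opens L :=
  mkopen (bigjoin [set a : L | open_subl a `<=` S]).

Lemma closure_compl_open (d : Order.disp_t) (L : frameType d) (S : set L) :
  `[< exists a : L, sublocale_compl (closure_subl S) = open_subl a >].
Proof.
by apply/asboolP; exists (bigmeet S); rewrite sublocale_compl_closed.
Qed.

(* (cl S)^c, as an element of the poset of open sublocales. *)
Definition closure_compl (d : Order.disp_t) (L : frameType d) (S : set L) : opens L :=
  @MkOpens d L (sublocale_compl (closure_subl S)) (closure_compl_open S).

Section Maps.
Context (dL dM : Order.disp_t) (L : frameType dL) (M : frameType dM).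

Definition frame_hom (h : M -> L) : Prop :=
  [/\ forall A : set M, h (bigjoin A) = bigjoin (h @` A),
      h \bot = \bot, h \top = \top &
      forall x y : M, h (x `&` y)%O = (h x `&` h y)%O].

End Maps.

(* Order preservation of g and h is a consequence of the equivalence. *)
Definition adjoint (dX dY : Order.disp_t) (X : porderType dX) (Y : porderType dY)
    (g : X -> Y) (h : Y -> X) : Prop :=
  forall (x : X) (y : Y), (g x <= y) <-> (x <= h y).

Section OpenMaps.
Context (dL dM : Order.disp_t) (L : frameType dL) (M : frameType dM).
Implicit Type f : L -> M.

Definition localic f : Prop := exists h : M -> L, frame_hom h /\ adjoint h f.

Definition open_map f : Prop :=
  forall a : L, exists b : M, f @` open_subl a = open_subl b.

Definition open_localic f : Prop := localic f /\ open_map f.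

Definition image_int f (U : opens L) : opens M :=
  interior_subl (f @` (U : set L)).

(* Sends o(a) to (cl f[c(a)])^c: see image_clcE. *)
Definition image_clc f (U : opens L) : opens M :=
  closure_compl (f @` closed_subl (opens_idx U)).

Definition preimage_int f (V : opens M) : opens L :=
  interior_subl (f @^-1` (V : set M)).

Lemma image_intE f a :
  image_int f (mkopen a) = interior_subl (f @` open_subl a).
Proof. by []. Qed.

Lemma image_clcE f a :
  image_clc f (mkopen a) = closure_compl (f @` closed_subl a).
Proof. by rewrite /image_clc mkopenK. Qed.

Lemma preimage_intE f b :
  preimage_int f (mkopen b) = interior_subl (f @^-1` open_subl b).
Proof. by []. Qed.

Lemma image_int_homo f : {homo image_int f : U V / U <= V}.
Proof.
move=> U V; rewrite !opens_leE => UV; apply/open_subl_le; apply: bigjoinS.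
by move=> b /= /subset_trans; apply; exact: image_subset.
Qed.

Lemma preimage_int_homo f : {homo preimage_int f : U V / U <= V}.
Proof.
move=> U V; rewrite !opens_leE => UV; apply/open_subl_le; apply: bigjoinS.
by move=> b /= /subset_trans; apply; exact: preimage_subset.
Qed.

Lemma image_clc_homo f : {homo image_clc f : U V / U <= V}.
Proof.
move=> U V; rewrite -{1}(opens_idxK U) -{1}(opens_idxK V) !opens_leE /=.
move=> /open_subl_le UV; rewrite !sublocale_compl_closed; apply/open_subl_le.
by apply: bigmeetS; apply: image_subset => x /=; exact: le_trans.
Qed.

End OpenMaps.

(* Main.v *)
(* On indices of open sublocales, the three maps become
   [i a] = join of the [b] with [o(b) <= f[o(a)]], [p b] = join of the [a] with
   [o(a) <= f^-1[o(b)]], and [f] itself, because [f a] is the least element of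
   [f[c(a)]].  So the second adjunction says that [f] has the left adjoint [p],
   and the first one that [p] preserves meets, i.e. that [f] is localic.
   Moreover, for a localic map with left adjoint [h], [o(h b)] is the largest
   open sublocale inside [f^-1[o(b)]], so that [p = h]; and [f[o(a)]] is closed
   under meets, so that [o(i a) <= f[o(a)]].  The unit [a <= p (i a)] of the
   first adjunction gives the reverse inclusion. *)
Require Import Defs.
From mathcomp Require Import all_boot all_order.
From mathcomp Require Import boolp classical_sets.

Set Implicit Arguments.
Unset Strict Implicit.
Unset Printing Implicit Defensive.

Import Order.TTheory.
Local Open Scope classical_set_scope.
Local Open Scope order_scope.

Section Adjoints.
Context (dX dY : Order.disp_t).
Context (X : porderType dX) (Y : porderType dY) (g : X -> Y) (h : Y -> X).
Hypothesis gh : adjoint g h.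

Lemma adjoint_unit x : x <= h (g x).
Proof. exact/gh. Qed.

Lemma adjoint_counit y : g (h y) <= y.
Proof. exact/gh. Qed.

Lemma adjoint_homol : {homo g : x x' / x <= x'}.
Proof. by move=> x x' xx'; apply/gh/(le_trans xx')/adjoint_unit. Qed.

Lemma adjoint_homor : {homo h : y y' / y <= y'}.
Proof. by move=> y y' yy'; apply/gh; exact: le_trans (adjoint_counit y) yy'. Qed.

End Adjoints.

Lemma adjoint_bigjoin (dX dY : Order.disp_t)
    (X : completeLatticeType dX) (Y : completeLatticeType dY)
    (g : X -> Y) (h : Y -> X) (A : set X) :
  adjoint g h -> g (bigjoin A) = bigjoin (g @` A).
Proof.
move=> gh; apply: le_anti; apply/andP; split.
  apply/gh; apply: bigjoin_le => a Aa; apply/gh.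
  by apply: bigjoin_ub; exists a.
apply: bigjoin_le => _ [a Aa <-].
by apply: (adjoint_homol gh); exact: bigjoin_ub.
Qed.

Lemma adjoint_bigmeet (dX dY : Order.disp_t)
    (X : completeLatticeType dX) (Y : completeLatticeType dY)
    (g : X -> Y) (h : Y -> X) (A : set Y) :
  adjoint g h -> h (bigmeet A) = bigmeet (h @` A).
Proof.
move=> gh; apply: le_anti; apply/andP; split.
  apply: le_bigmeet => _ [a Aa <-].
  by apply: (adjoint_homor gh); exact: bigmeet_lb.
apply/gh; apply: le_bigmeet => a Aa; apply/gh.
by apply: bigmeet_lb; exists a.
Qed.

(** As a left adjoint [h] preserves joins and [\bot]; as a right adjoint it preserves finite meets
    and [\top]. *)
Lemma adjoint_frame_hom (dL dM : Order.disp_t) (L : frameType dL)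
    (M : frameType dM) (i : L -> M) (h : M -> L) (f : L -> M) :
  adjoint i h -> adjoint h f -> frame_hom h.
Proof.
move=> ih hf; split.
- by move=> A; exact: adjoint_bigjoin hf.
- by apply/eqP; rewrite -lex0; apply/hf; exact: le0x.
- by apply/eqP; rewrite -le1x; apply/ih; exact: lex1.
- move=> x y; apply: le_anti; apply/andP; split.
    by rewrite lexI !(adjoint_homor ih) ?leIl ?leIr.
  by apply/ih; rewrite lexI; apply/andP; split; apply/ih; rewrite ?leIl ?leIr.
Qed.

(** [mkopen] is an order isomorphism with inverse [opens_idx], so adjunctions can be checked on
    indices. *)
Lemma adjoint_mkopen (dL dM : Order.disp_t) (L : frameType dL)
    (M : frameType dM) (G : opens L -> opens M) (H : opens M -> opens L)
    (g : L -> M) (h : M -> L) :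
  (forall a, G (mkopen a) = mkopen (g a)) ->
  (forall b, H (mkopen b) = mkopen (h b)) ->
  adjoint G H <-> adjoint g h.
Proof.
have mkopen_le d (N : frameType d) (a b : N) :
  (mkopen a <= mkopen b) <-> (a <= b) by rewrite opens_leE; exact: open_subl_le.
move=> Gg Hh; split=> [GH a b|gh U V].
  by rewrite -(mkopen_le _ _ (g a)) -(mkopen_le _ _ a) -Gg -Hh.
rewrite -(opens_idxK U) -(opens_idxK V) Gg Hh.
by rewrite !mkopen_le.
Qed.

(** A point [x] of the large open sublocale equals [himp (bigjoin B) x], which is the meet of the
    [himp b x] for [b] in [B], and each [himp b x] lies in [open_subl b]. *)
Lemma bigmeet_closed_open_subl (d : Order.disp_t) (L : frameType d)
    (S B : set L) :
  (forall A, A `<=` S -> S (bigmeet A)) ->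
  (forall b, B b -> open_subl b `<=` S) -> open_subl (bigjoin B) `<=` S.
Proof.
move=> SI BS x xB.
have -> : x = bigmeet [set himp b x | b in B].
  apply: le_anti; apply/andP; split.
    by apply: le_bigmeet => _ [b _ <-]; exact: le_himp.
  rewrite -[leRHS]xB -himpP meetC himpP.
  apply: bigjoin_le => b Bb; rewrite -himpP meetC himpP.
  by apply: bigmeet_lb; exists b.
by apply: SI => _ [b Bb <-]; apply: (BS b) => //; exact: himp_idem.
Qed.

Section LocalicMaps.
Context (dL dM : Order.disp_t) (L : frameType dL) (M : frameType dM).
Implicit Types (f : L -> M) (h : M -> L).

Definition int_idx f (a : L) : M := bigjoin [set b | open_subl b `<=` f @` open_subl a].

Definition preint_idx f (b : M) : L :=
  bigjoin [set a | open_subl a `<=` f @^-1` open_subl b].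

Lemma image_clc_mkopen f a : {homo f : x y / x <= y} ->
  image_clc f (mkopen a) = mkopen (f a).
Proof.
move=> f_homo; rewrite image_clcE; apply: val_inj => /=.
rewrite sublocale_compl_closed; congr open_subl.
apply: le_anti; apply/andP; split.
  by apply: bigmeet_lb; exists a => //; exact: lexx.
by apply: le_bigmeet => _ [x ax <-]; exact: f_homo.
Qed.

(** Both sides have the same lower bounds: for either one, [y] is below it iff [h y] meet [h b],
    that is [h] of [y] meet [b], is below [x]. *)
Lemma localic_himp h f b x : frame_hom h -> adjoint h f ->
  f (himp (h b) x) = himp b (f x).
Proof.
move=> [_ _ _ hI] hf.
have le_f y : (y <= f (himp (h b) x)) = (y <= himp b (f x)).
  rewrite -himpP; apply/idP/idP.
    by move=> /hf; rewrite -himpP -hI => /hf.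
  by move=> /hf; rewrite hI himpP => /hf.
by apply: le_anti; rewrite le_f lexx -le_f lexx.
Qed.

Lemma open_subl_preimage h f a b : frame_hom h -> adjoint h f ->
  open_subl a `<=` f @^-1` open_subl b <-> a <= h b.
Proof.
move=> hh hf; split=> [ab|/open_subl_le ab x /ab xb]; last first.
  by rewrite /open_subl /= -(localic_himp _ _ hh hf) xb.
(* The inclusion is tested at the point [himp a (h b)] of [open_subl a]. Since [h b] lies below it,
   [localic_himp] forces its image to be [f \top], which is [\top]; the adjunction and
   [h \top = \top] then make the point itself [\top]. *)
have /= := ab _ (himp_idem a (h b)).
rewrite /open_subl /= -(localic_himp _ _ hh hf) himp_top ?le_himp // => f1.
have /hf : \top <= f (himp a (h b)) by rewrite -f1; apply/hf; exact: lex1.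
by case: hh => _ _ -> _; rewrite -himpP meet1x.
Qed.

Lemma localic_preint_idx h f : frame_hom h -> adjoint h f ->
  preint_idx f =1 h.
Proof.
move=> hh hf b; apply: le_anti; apply/andP; split.
  by apply: bigjoin_le => a /(open_subl_preimage _ _ hh hf).
by apply: bigjoin_ub; apply/(open_subl_preimage _ _ hh hf).
Qed.

Lemma open_subl_int_idx h f a : adjoint h f ->
  open_subl (int_idx f a) `<=` f @` open_subl a.
Proof.
move=> hf; apply: bigmeet_closed_open_subl => // A AS.
(* Taking all points of [open_subl a] sent into [A] avoids choosing one preimage per element; [f], a
   right adjoint, preserves their meet. *)
exists (bigmeet (open_subl a `&` f @^-1` A)).
  by apply: (open_is_sublocale a).1 => x [].
rewrite (adjoint_bigmeet _ hf); congr bigmeet; apply/seteqP; split.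
  by move=> _ [x [_ Ax] <-].
by move=> y Ay; have [x xa xy] := AS _ Ay; exists x => //; split=> //=; rewrite xy.
Qed.

Lemma open_localic_adjoint f : open_localic f <->
  adjoint (int_idx f) (preint_idx f) /\ adjoint (preint_idx f) f.
Proof.
split=> [[[h [hh hf]] f_open]|[ip pf]].
  have -> : preint_idx f = h by apply/funext; exact: localic_preint_idx.
  split=> // a b; have [c fc] := f_open a.
  have -> : int_idx f a = c.
    apply: le_anti; apply/andP; split.
      by apply: bigjoin_le => y /=; rewrite fc => /open_subl_le.
    by apply: bigjoin_ub; rewrite /= fc.
  (* With [open_subl c] equal to the image of [open_subl a], the first adjunction reduces to that
     between direct image and preimage of sets. *)
  by rewrite -open_subl_le -fc image_sub -(open_subl_preimage a b hh hf).
have hp := adjoint_frame_hom ip pf.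
split=> [|a]; first by exists (preint_idx f).
exists (int_idx f a); apply/seteqP; split; last exact: open_subl_int_idx pf.
rewrite image_sub; apply/(open_subl_preimage _ _ hp pf).
exact: adjoint_unit.
Qed.

End LocalicMaps.

Theorem corollary3p3p3 (dL dM : Order.disp_t) (L : frameType dL) (M : frameType dM)
    (f : L -> M) (hf : {homo f : x y / (x <= y)%O}) :
  open_localic f <->
  adjoint (image_int f) (preimage_int f) /\ adjoint (preimage_int f) (image_clc f).
Proof.
rewrite (adjoint_mkopen (image_intE f) (preimage_intE f)).
rewrite (adjoint_mkopen (preimage_intE f) (fun a => image_clc_mkopen a hf)).
exact: open_localic_adjoint.
Qed.
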